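(* Let $M>0$ and let $f(z)=h(z)+\overline{g(z)}$ be a harmonic mapping of the unit disk $U$, where $h(z)=\sum_{n=1}^{\infty}a_nz^n$ and $g(z)=\sum_{n=1}^{\infty}b_nz^n$ are analytic on $U$. If $|h(z)|+|g(z)|\le M$ for all $z\in U$ and $\lambda_f(0)=1$, then $M\ge 1$ and $$|a_n|+|b_n|\le M-\frac1M\qquad\text{for all } n=2,3,\dots.$$ These estimates are sharp for all $n=2,3,\dots$: for each $M\ge1$ and each $n\ge 2$, the functions $f_{1,n}(z)$ and $\overline{f_{1,n}(z)}$, where $$f_{1,n}(z)=Mz\cdot\frac{1-Mz^{n-1}}{M-z^{n-1}},$$ are extremal, i.e. they satisfy the hypotheses and give equality in the estimate with index $n$.
   Context: $U=\{z\in\mathbb{C}:|z|<1\}$ is the open unit disk. A harmonic mapping is a complex-valued harmonic function (not assumed injective). For a differentiable complex-valued function $f$, with $z=x+iy$, put $f_z=\frac12(f_x-if_y)$, $f_{\overline z}=\frac12(f_x+if_y)$, and $\lambda_f(z)=\bigl||f_z(z)|-|f_{\overline z}(z)|\bigr|$. In particular, for $f=h+\overline g$ as in the claim, $\lambda_f(0)=\bigl||a_1|-|b_1|\bigr|$. *)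

(* Defs.v *)
From Stdlib Require Import Reals.
From Coquelicot Require Import Coquelicot.

Open Scope R_scope.

Definition unit_disk (z : C) : Prop := Cmod z < 1.

(* Partial derivatives of f at z = x + iy in the real variables x and y.
   Coquelicot's [Derive] is total; it is only meaningful where the component
   functions of f are differentiable. *)
Definition dx (f : C -> C) (z : C) : C :=
  (Derive (fun t : R => Re (f (t, Im z))) (Re z),
   Derive (fun t : R => Im (f (t, Im z))) (Re z)).

Definition dy (f : C -> C) (z : C) : C :=
  (Derive (fun t : R => Re (f (Re z, t))) (Im z),
   Derive (fun t : R => Im (f (Re z, t))) (Im z)).

Definition dz (f : C -> C) (z : C) : C :=
  (/ 2 * (dx f z - Ci * dy f z))%C.

Definition dzbar (f : C -> C) (z : C) : C :=
  (/ 2 * (dx f z + Ci * dy f z))%C.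

Definition lambda (f : C -> C) (z : C) : R :=
  Rabs (Cmod (dz f z) - Cmod (dzbar f z)).

(* Since D will be open, requiring [ex_diff_n _ 2] at each of its points says
   that u is of class C^2 on D. *)
Definition real_harmonic_on (D : C -> Prop) (u : R -> R -> R) : Prop :=
  forall x y : R, D (x, y) ->
    ex_diff_n u 2 x y /\
    partial_derive 2 0 u x y + partial_derive 0 2 u x y = 0.

Definition harmonic_on (D : C -> Prop) (f : C -> C) : Prop :=
  real_harmonic_on D (fun x y => Re (f (x, y))) /\
  real_harmonic_on D (fun x y => Im (f (x, y))).

(* h is analytic on the unit disk with power series sum_(n >= 1) a_n z^n:
   Coquelicot's power series start at index 0, whence [a 0 = 0]. *)
Definition disk_series (a : nat -> C) (h : C -> C) : Prop :=
  a 0%nat = 0 /\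
  forall z : C, unit_disk z -> @is_pseries C_AbsRing C_NormedModule a z (h z).

Record bounded_harmonic_pair (M : R) (f h g : C -> C) (a b : nat -> C) : Prop := {
  bhp_harmonic : harmonic_on unit_disk f;
  bhp_decomp : forall z : C, unit_disk z -> f z = (h z + Cconj (g z))%C;
  bhp_h : disk_series a h;
  bhp_g : disk_series b g;
  bhp_bound : forall z : C, unit_disk z -> Cmod (h z) + Cmod (g z) <= M;
  bhp_lambda : lambda f 0 = 1
}.

Definition f1 (M : R) (n : nat) (z : C) : C :=
  (M * z * ((1 - M * z ^ (n - 1)) / (M - z ^ (n - 1))))%C.

Definition extremal (M : R) (n : nat) (f : C -> C) : Prop :=
  exists (h g : C -> C) (a b : nat -> C),
    bounded_harmonic_pair M f h g a b /\
    Cmod (a n) + Cmod (b n) = M - 1 / M.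

(* Main.v *)
Require Import Defs.
From Stdlib Require Import Reals Lra Lia Psatz.
From Coquelicot Require Import Coquelicot.
Open Scope R_scope.

(** For every complex number [u] of modulus one, [F = h + u * g] is analytic in
    the disk, vanishes at 0 and satisfies [|F| <= |h| + |g| <= M]. Its
    coefficients are [A n = a n + u * b n]. A bounded analytic function with
    [F 0 = 0] satisfies [M * |A n| + |A 1| ^ 2 <= M ^ 2] for [n >= 2]
    ([bounded_series_coef]). Since [lambda f 0 = | |a 1| - |b 1| |]
    ([lambda_harmonic_pair_0]) equals 1, one has [|A 1| >= 1] whatever [u] is, and
    [u] can be chosen with [|A n| = |a n| + |b n|]. Hence
    [M * (|a n| + |b n|) + 1 <= M ^ 2], which contains both [M >= 1] and the
    estimate.

    The coefficient inequality comes from multiplying [F] by [al + be * z ^ (n-1)]: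
    on each circle the product is at most [M] times the binomial, so in mean
    square its coefficients [al * A 1] at [z] and [al * A n + be * A 1] at [z ^ n]
    satisfy [|al * A 1| ^ 2 + |al * A n + be * A 1| ^ 2 <=
    M ^ 2 * (|al| ^ 2 + |be| ^ 2)]. Optimizing over [al] and [be] gives the claim
    ([toeplitz_bound]). The mean squares are taken over roots of unity, after
    replacing [F] by its partial sums: for polynomials Parseval's identity over
    sufficiently many roots of unity is exact ([parseval_unity]).

    For the sharpness, [f1 M n] is a rational function without poles in the
    disk: it is holomorphic, hence it and its conjugate are harmonic
    ([Re_holomorphic_harmonic]); it is bounded by [M] because
    [|1 - M w| <= |M - w|] for [|w| < 1]; and the expansion of
    [z / (M - z ^ (n-1))] in a geometric series shows that its coefficients of
    index 1 and [n] are 1 and [-(M - 1 / M)]. *)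

(** Equalities of sums and series live over carriers such as
    [AbelianMonoid.sort C_AbelianMonoid]; [ring] and [field] look their
    structure up syntactically and only find it at [C]. *)
Ltac ceq := match goal with |- @eq _ ?a ?b => change (@eq C a b) end.

Notation is_Cseries := (@is_series C_AbsRing C_NormedModule).

(** * Parseval's identity on the roots of unity *)

Definition peval (c : nat -> C) (n : nat) (z : C) : C :=
  sum_n (fun m => (c m * z ^ m)%C) n.

Lemma Csum_mult_l (c : C) (u : nat -> C) (n : nat) :
  sum_n (fun k => (c * u k)%C) n = (c * sum_n u n)%C.
Proof. apply (sum_n_mult_l (K := C_Ring)). Qed.

Lemma Csum_mult_r (c : C) (u : nat -> C) (n : nat) :
  sum_n (fun k => (u k * c)%C) n = (sum_n u n * c)%C.
Proof. apply (sum_n_mult_r (K := C_Ring)). Qed.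

Lemma sum_n_geom_C (w : C) (n : nat) :
  ((1 - w) * sum_n (fun j => (w ^ j)%C) n = 1 - w ^ S n)%C.
Proof.
induction n as [|n IH].
- rewrite sum_O. simpl. ring.
- rewrite sum_Sn. change plus with Cplus. rewrite Cmult_plus_distr_l, IH. simpl. ring.
Qed.

Lemma primitive_root_exists (L : nat) : (0 < L)%nat ->
  exists w : C, Cmod w = 1 /\ (w ^ L = 1)%C /\
    forall d : nat, (0 < d < L)%nat -> (w ^ d <> 1)%C.
Proof.
intros HL.
assert (HL' : 0 < INR L) by (apply lt_0_INR; lia).
set (t := 2 * PI / INR L).
assert (Hpow : forall d, ((cos t, sin t) ^ d)%C = (cos (INR d * t), sin (INR d * t))).
{ induction d as [|d IH].
  - simpl. rewrite Rmult_0_l, cos_0, sin_0. reflexivity.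
  - rewrite Cpow_S, IH, S_INR. unfold Cmult; simpl.
    replace ((INR d + 1) * t) with (t + INR d * t) by ring.
    rewrite cos_plus, sin_plus. f_equal; ring. }
exists (cos t, sin t). split; [|split].
- unfold Cmod; simpl.
  replace (cos t * (cos t * 1) + sin t * (sin t * 1)) with 1.
  apply sqrt_1.
  generalize (sin2_cos2 t); unfold Rsqr; lra.
- rewrite Hpow. replace (INR L * t) with (2 * PI) by (unfold t; field; lra).
  rewrite cos_2PI, sin_2PI. reflexivity.
- intros d Hd. rewrite Hpow. intros E. injection E as E _.
  assert (Hd1 : 0 < INR d) by (apply lt_0_INR; lia).
  assert (Hd2 : INR d < INR L) by (apply lt_INR; lia).
  assert (Hpos : 0 < sin (INR d * t / 2)).
  { assert (Hpi := PI_RGT_0). unfold t. apply sin_gt_0.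
    - apply Rdiv_lt_0_compat; [|lra]. apply Rmult_lt_0_compat; [lra|].
      apply Rdiv_lt_0_compat; lra.
    - replace (INR d * (2 * PI / INR L) / 2) with (PI * (INR d / INR L)) by (field; lra).
      rewrite <- (Rmult_1_r PI) at 2. apply Rmult_lt_compat_l; [lra|].
      apply Rlt_div_l; lra. }
  (* cos x = 1 - 2 sin (x/2) ^ 2 is smaller than 1 for 0 < x < 2 PI *)
  replace (INR d * t) with (2 * (INR d * t / 2)) in E by field.
  rewrite cos_2a_sin in E. nra.
Qed.

Lemma sum_n_zero {G : AbelianMonoid} (n : nat) (f : nat -> G) :
  (forall m, (m <= n)%nat -> f m = zero) -> sum_n f n = zero.
Proof.
induction n as [|n IH]; intros Hf.
- rewrite sum_O. apply Hf; lia.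
- rewrite sum_Sn, IH, Hf by (intros; try apply Hf; lia). apply plus_zero_l.
Qed.

Lemma sum_n_single {G : AbelianMonoid} (k n : nat) (f : nat -> G) : (k <= n)%nat ->
  (forall m, (m <= n)%nat -> m <> k -> f m = zero) -> sum_n f n = f k.
Proof.
intros Hk Hf.
induction n as [|n IH].
- replace k with 0%nat by lia. apply sum_O.
- rewrite sum_Sn. destruct (Nat.eq_dec k (S n)) as [->|E].
  + rewrite sum_n_zero by (intros; apply Hf; lia). apply plus_zero_l.
  + rewrite IH by (intros; try apply Hf; lia).
    rewrite (Hf (S n)) by lia. apply plus_zero_r.
Qed.

Lemma Cconj_sum_n (f : nat -> C) (n : nat) :
  Cconj (sum_n f n) = sum_n (fun m => Cconj (f m)) n.
Proof.
induction n as [|n IH]; [now rewrite !sum_O|].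
rewrite !sum_Sn, <- IH. apply Cplus_conj.
Qed.

Lemma RtoC_sum_n (f : nat -> R) (n : nat) :
  RtoC (sum_n f n) = sum_n (fun m => RtoC (f m)) n.
Proof.
induction n as [|n IH]; [now rewrite !sum_O|].
rewrite !sum_Sn, <- IH. apply RtoC_plus.
Qed.

Lemma Cpow_root_inj (w : C) (n m k : nat) : w <> 0 ->
  (forall d : nat, (0 < d < S n)%nat -> (w ^ d <> 1)%C) ->
  (m <= n)%nat -> (k <= n)%nat -> (w ^ m = w ^ k)%C -> m = k.
Proof.
intros Hnz Hd.
assert (H : forall a b, (a < b <= n)%nat -> (w ^ a)%C <> (w ^ b)%C).
{ intros a b Hab E. apply (Hd (b - a)%nat); [lia|].
  replace b with (a + (b - a))%nat in E by lia.
  rewrite Cpow_add_r in E.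
  apply (f_equal (fun x => x / w ^ a)%C) in E.
  assert (Hp := Cpow_nz w a Hnz).
  transitivity (w ^ a * w ^ (b - a) / w ^ a)%C; [field; exact Hp|].
  rewrite <- E. field; exact Hp. }
intros Hm Hk E.
destruct (Nat.lt_trichotomy m k) as [Hl|[He|Hl]]; [|exact He|];
  exfalso; eapply H; [|exact E| |symmetry; exact E]; lia.
Qed.

(** Expanding the squared moduli and exchanging the sums leaves, for each pair
    of coefficients, the sum of the powers of [w ^ m * conj w ^ k]: a geometric
    sum that vanishes unless [m = k], because more points are sampled than the
    degree. *)
Lemma parseval_unity (w : C) (c : nat -> C) (n : nat) :
  Cmod w = 1 -> (w ^ S n = 1)%C ->
  (forall d : nat, (0 < d < S n)%nat -> (w ^ d <> 1)%C) ->
  sum_n (fun j => Cmod (peval c n (w ^ j)%C) ^ 2) n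
  = INR (S n) * sum_n (fun m => Cmod (c m) ^ 2) n.
Proof.
intros Hw HL Hd.
assert (Hww : (w * Cconj w = 1)%C).
{ rewrite <- Cmod2_conj, Hw. rewrite pow1. reflexivity. }
apply RtoC_inj.
rewrite RtoC_mult, !RtoC_sum_n.
transitivity (sum_n (fun j => sum_n (fun m => sum_n (fun k =>
  (c m * Cconj (c k) * (w ^ m * Cconj w ^ k) ^ j)%C) n) n) n).
{ apply sum_n_ext; intros j.
  rewrite Cmod2_conj. unfold peval.
  rewrite Cconj_sum_n.
  rewrite <- Csum_mult_r. apply sum_n_ext; intros m.
  rewrite <- Csum_mult_l. apply sum_n_ext; intros k.
  rewrite Cmult_conj, !Cpow_conj, Cpow_mult_l, <- !Cpow_mult_r.
  rewrite (Nat.mul_comm m j), (Nat.mul_comm k j). ceq. ring. }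
rewrite sum_n_switch.
rewrite <- Csum_mult_l.
apply sum_n_ext_loc; intros m Hm.
rewrite sum_n_switch.
rewrite (sum_n_single m n); [| exact Hm |].
- rewrite Cmod2_conj.
  transitivity (sum_n (fun j : nat => RtoC (Cmod (c m) ^ 2)) n).
  + apply sum_n_ext; intros j.
    ceq. rewrite <- Cpow_mult_l, Hww, !Cpow_1_l, Cmod2_conj. ring.
  + rewrite <- RtoC_sum_n, sum_n_const, RtoC_mult, Cmod2_conj. reflexivity.
- intros k Hk Hne.
  rewrite Csum_mult_l.
  set (v := (w ^ m * Cconj w ^ k)%C).
  assert (HvL : (v ^ S n = 1)%C).
  { unfold v. rewrite Cpow_mult_l, <- !Cpow_mult_r, (Nat.mul_comm m), (Nat.mul_comm k).
    rewrite !Cpow_mult_r, <- Cpow_conj, HL, !Cpow_1_l.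
    rewrite <- Cpow_conj, Cpow_1_l. unfold Cconj; simpl.
    apply injective_projections; simpl; ring. }
  assert (Hv1 : v <> 1).
  { intros E. apply Hne. symmetry. apply (Cpow_root_inj w n); auto.
    { apply Cmod_gt_0. lra. }
    transitivity (v * w ^ k)%C.
    - unfold v. rewrite <- Cmult_assoc, <- Cpow_mult_l, (Cmult_comm (Cconj w)), Hww, Cpow_1_l.
      ring.
    - rewrite E. ring. }
  assert (Hs : sum_n (fun j => (v ^ j)%C) n = RtoC 0).
  { assert (G := sum_n_geom_C v n). rewrite HvL in G.
    destruct (Ceq_dec (sum_n (fun j => (v ^ j)%C) n) 0) as [|Hnz]; [assumption|].
    exfalso. apply (Cmult_neq_0 (1 - v)%C (sum_n (fun j => (v ^ j)%C) n)).
    - intros E. apply Hv1. transitivity (1 - (1 - v))%C; [ring|]. rewrite E; ring.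
    - exact Hnz.
    - rewrite G. ring. }
  transitivity (c m * Cconj (c k) * 0)%C; [exact (f_equal _ Hs) | apply Cmult_0_r].
Qed.

(** * A Toeplitz inequality for the coefficients of a bounded polynomial *)

Definition shift (p : nat) (c : nat -> C) (m : nat) : C :=
  if (p <=? m)%nat then c (m - p)%nat else 0.

(** The coefficients of the product of [al + be * z ^ p] with the polynomial
    whose coefficients are [c]. *)
Definition bincoef (al be : C) (p : nat) (c : nat -> C) (m : nat) : C :=
  (al * c m + be * shift p c m)%C.

Lemma peval_extend (c : nat -> C) (n p : nat) (z : C) :
  (forall m, (n < m)%nat -> c m = 0) -> peval c (n + p) z = peval c n z.
Proof.
intros Hc. induction p as [|p IH]; [now rewrite Nat.add_0_r|].
rewrite Nat.add_succ_r. unfold peval in *. rewrite sum_Sn, IH, Hc by lia.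
rewrite Cmult_0_l. apply Cplus_0_r.
Qed.

Lemma peval_shift (p : nat) (c : nat -> C) (n : nat) (z : C) :
  peval (shift p c) (n + p) z = (z ^ p * peval c n z)%C.
Proof.
unfold peval. rewrite <- Csum_mult_l.
induction n as [|n IH].
- rewrite sum_O. rewrite (sum_n_single p); simpl; [|lia|].
  + unfold shift. rewrite Nat.leb_refl, Nat.sub_diag. simpl. ceq. ring.
  + intros m H1 H2. unfold shift. destruct (Nat.leb_spec p m); [lia|].
    apply Cmult_0_l.
- rewrite Nat.add_succ_l, !sum_Sn, IH. f_equal.
  unfold shift. destruct (Nat.leb_spec p (S (n + p))); [|lia].
  replace (S (n + p) - p)%nat with (S n) by lia.
  replace (S (n + p))%nat with (p + S n)%nat by lia.
  rewrite Cpow_add_r. ring.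
Qed.

Lemma peval_bincoef (al be : C) (p : nat) (c : nat -> C) (n : nat) (z : C) :
  (forall m, (n < m)%nat -> c m = 0) ->
  peval (bincoef al be p c) (n + p) z = ((al + be * z ^ p) * peval c n z)%C.
Proof.
intros Hc.
transitivity (al * peval c (n + p) z + be * peval (shift p c) (n + p) z)%C.
- unfold peval. rewrite <- !Csum_mult_l.
  change Cplus with (@plus C_AbelianMonoid). rewrite <- sum_n_plus.
  apply sum_n_ext; intros m. unfold bincoef.
  change (@plus C_AbelianMonoid) with Cplus. ceq. ring.
- rewrite peval_extend, peval_shift by assumption. ring.
Qed.

Lemma sum_n_two_R (i j n : nat) (x y : R) : (i <= n)%nat -> (j <= n)%nat ->
  sum_n (fun m => (if (m =? i)%nat then x else 0) + (if (m =? j)%nat then y else 0)) n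
  = x + y.
Proof.
intros Hi Hj.
change Rplus with (@plus R_AbelianMonoid) at 1.
rewrite sum_n_plus, (sum_n_single i), (sum_n_single j), !Nat.eqb_refl; auto.
- intros m _ H. apply Nat.eqb_neq in H. now rewrite H.
- intros m _ H. apply Nat.eqb_neq in H. now rewrite H.
Qed.

(** On the unit circle the product of [c] with the binomial [al + be * z ^ p] is
    at most [K] times the binomial, hence so it is in mean square; Parseval's
    identity turns this into an inequality of coefficients. On the left only
    the coefficients of index [1] and [p + 1] of the product are kept; the first
    one is [al * c 1] even for [p = 1], thanks to [c 0 = 0]. *)
Lemma poly_bessel (c : nat -> C) (N p : nat) (K : R) (al be : C) :
  (1 <= p)%nat -> (1 <= N)%nat -> c 0%nat = 0 ->
  (forall m, (N < m)%nat -> c m = 0) ->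
  (forall z, Cmod z = 1 -> Cmod (peval c N z) <= K) ->
  Cmod (al * c 1%nat)%C ^ 2 + Cmod (al * c (S p) + be * c 1%nat)%C ^ 2
  <= K ^ 2 * (Cmod al ^ 2 + Cmod be ^ 2).
Proof.
intros Hp HN H0 Hc HK.
set (L := (N + p)%nat).
destruct (primitive_root_exists (S L)) as [w (Hw & HwL & Hwd)]; [lia|].
assert (HLpos : 0 < INR (S L)) by (apply lt_0_INR; lia).
(* e = 1 as a polynomial, so that bincoef al be p e is the binomial itself *)
set (e := fun m => if (m =? 0)%nat then RtoC 1 else RtoC 0).
assert (He : forall z, peval e N z = 1).
{ intros z. unfold peval. rewrite (sum_n_single 0); [| lia |].
  - unfold e; simpl. ceq. ring.
  - intros m _ Hm. unfold e. apply Nat.eqb_neq in Hm. rewrite Hm. apply Cmult_0_l. }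
assert (P1 := parseval_unity w (bincoef al be p c) L Hw HwL Hwd).
assert (P2 := parseval_unity w (bincoef al be p e) L Hw HwL Hwd).
assert (Hle : sum_n (fun m => Cmod (bincoef al be p c m) ^ 2) L
  <= K ^ 2 * sum_n (fun m => Cmod (bincoef al be p e m) ^ 2) L).
{ apply (Rmult_le_reg_l (INR (S L))); [assumption|].
  rewrite <- P1.
  replace (INR (S L) * (K ^ 2 * sum_n (fun m => Cmod (bincoef al be p e m) ^ 2) L))
    with (K ^ 2 * (INR (S L) * sum_n (fun m => Cmod (bincoef al be p e m) ^ 2) L)) by ring.
  rewrite <- P2.
  change Rmult with (@mult R_Ring) at 1. rewrite <- (sum_n_mult_l (K := R_Ring)).
  apply sum_n_m_le; intros j. change (@mult R_Ring) with Rmult.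
  unfold L. rewrite !peval_bincoef; [|intros [|m] Hm; [lia|reflexivity]|exact Hc].
  rewrite He, Cmult_1_r, Cmod_mult, Rpow_mult_distr, Rmult_comm.
  apply Rmult_le_compat_r; [apply pow2_ge_0|].
  apply pow_incr. split; [apply Cmod_ge_0|].
  apply HK. rewrite Cmod_pow, Hw, pow1. reflexivity. }
replace (Cmod al ^ 2 + Cmod be ^ 2)
  with (sum_n (fun m => Cmod (bincoef al be p e m) ^ 2) L).
- eapply Rle_trans; [|exact Hle].
  rewrite <- (sum_n_two_R 1 (S p) L) by (unfold L; lia).
  apply sum_n_m_le; intros m.
  assert (Hsq := pow2_ge_0 (Cmod (bincoef al be p c m))).
  destruct (Nat.eqb_spec m 1) as [E|_], (Nat.eqb_spec m (S p)) as [E'|_].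
  + lia.
  + rewrite Rplus_0_r, E. unfold bincoef, shift.
    destruct (Nat.leb_spec p 1).
    * replace (1 - p)%nat with 0%nat by lia. rewrite H0.
      right. do 2 f_equal. ring.
    * right. do 2 f_equal. ring.
  + rewrite Rplus_0_l, E'. unfold bincoef, shift.
    destruct (Nat.leb_spec p (S p)); [|lia].
    replace (S p - p)%nat with 1%nat by lia. lra.
  + lra.
- rewrite <- (sum_n_two_R 0 p L) by (unfold L; lia).
  apply sum_n_ext_loc; intros m _.
  unfold bincoef, shift, e.
  destruct (Nat.eqb_spec m 0) as [E|E], (Nat.eqb_spec m p) as [E'|E'],
    (Nat.leb_spec p m), (Nat.eqb_spec (m - p) 0); try lia;
  rewrite ?Cmult_0_r, ?Cmult_1_r, ?Cplus_0_l, ?Cplus_0_r, ?Cmod_0;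
  match goal with |- @eq _ ?a ?b => change (@eq R a b) end; ring.
Qed.

(** Rotating one summand aligns the two arguments. *)
Lemma phase_exists (x y : C) :
  exists u : C, Cmod u = 1 /\ Cmod (x + u * y)%C = Cmod x + Cmod y.
Proof.
destruct (Ceq_dec x 0) as [->|Hx].
{ exists 1. rewrite Cmod_1, Cmod_0. split; [reflexivity|].
  rewrite Rplus_0_l. f_equal. ring. }
destruct (Ceq_dec y 0) as [->|Hy].
{ exists 1. rewrite Cmod_1, Cmod_0. split; [reflexivity|].
  rewrite Rplus_0_r. f_equal. ring. }
assert (Hx' := proj1 (Cmod_gt_0 x) Hx). assert (Hy' := proj1 (Cmod_gt_0 y) Hy).
assert (RtoC (Cmod x) <> 0) by (intros E; apply RtoC_inj in E; lra).
assert (RtoC (Cmod y) <> 0) by (intros E; apply RtoC_inj in E; lra).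
exists ((x / Cmod x) * (Cmod y / y))%C. split.
- rewrite Cmod_mult, !Cmod_div, !Cmod_R, !Rabs_pos_eq by (assumption || lra).
  field; lra.
- replace (x + x / Cmod x * (Cmod y / y) * y)%C with (x * RtoC (1 + Cmod y / Cmod x)%R)%C.
  + rewrite Cmod_mult, Cmod_R, Rabs_pos_eq.
    * field; lra.
    * assert (0 < Cmod y / Cmod x) by (apply Rdiv_lt_0_compat; assumption). lra.
  + rewrite RtoC_plus, RtoC_div by lra. field. split; assumption.
Qed.

(** The hypothesis says that the matrix [[c1, 0], [cn, c1]] has norm at most
    [K]. After aligning arguments it is a quadratic form in two nonnegative
    reals whose discriminant gives [K * |cn| <= K ^ 2 - |c1| ^ 2]. *)
Lemma toeplitz_bound (c1 cn : C) (K : R) : 0 < K ->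
  (forall al be : C,
    Cmod (al * c1)%C ^ 2 + Cmod (al * cn + be * c1)%C ^ 2
    <= K ^ 2 * (Cmod al ^ 2 + Cmod be ^ 2)) ->
  K * Cmod cn + Cmod c1 ^ 2 <= K ^ 2.
Proof.
intros HK H.
assert (HR : forall x y : R, 0 <= x -> 0 <= y ->
  (x * Cmod c1) ^ 2 + (x * Cmod cn + y * Cmod c1) ^ 2 <= K ^ 2 * (x ^ 2 + y ^ 2)).
{ intros x y Hx Hy.
  destruct (phase_exists (x * cn) (y * c1)) as [u [Hu Hs]].
  specialize (H x (u * y)%C).
  replace (x * cn + u * y * c1)%C with (x * cn + u * (y * c1))%C in H by ring.
  rewrite Hs, !Cmod_mult, Hu, !Cmod_R, !Rabs_pos_eq, Rmult_1_l in H by assumption.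
  exact H. }
clear H.
assert (P1 := Cmod_ge_0 c1). assert (Pn := Cmod_ge_0 cn).
revert HR P1 Pn. generalize (Cmod c1) (Cmod cn). intros s t HR Hs Ht.
set (D := K ^ 2 - s ^ 2).
assert (HD : 0 <= D) by (assert (G := HR 0 1 ltac:(lra) ltac:(lra)); unfold D; nra).
assert (Ht2 : t = 0 \/ 0 < D).
{ destruct HD as [HD|HD]; [now right|left].
  assert (G := HR 1 0 ltac:(lra) ltac:(lra)). unfold D in HD. nra. }
destruct Ht2 as [->|HD']; [unfold D in HD; lra|].
(* for x = D the form D y^2 - 2 t s x y + (D - t^2) x^2 is least at y = t s *)
assert (G := HR D (t * s) HD ltac:(nra)).
assert (G2 : 0 <= D * (D ^ 2 - (K * t) ^ 2)).
{ replace (K ^ 2 * (D ^ 2 + (t * s) ^ 2)) with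
   ((D * s) ^ 2 + (D * t + t * s * s) ^ 2 + D * (D ^ 2 - (K * t) ^ 2)) in G; [lra|].
  unfold D. ring. }
assert (G3 : (K * t) ^ 2 <= D ^ 2) by nra.
assert (K * t <= D) by (apply Rsqr_incr_0_var; [unfold Rsqr; nra|assumption]).
unfold D in *; lra.
Qed.

(** * Coefficients of a bounded power series *)

Lemma is_series_C_eps (a : nat -> C) (l : C) :
  is_Cseries a l ->
  forall eps : R, 0 < eps ->
  exists N : nat, forall n, (N <= n)%nat -> Cmod (sum_n a n - l) < eps.
Proof.
intros H eps He.
exact (proj1 (filterlim_locally_ball_norm (sum_n a) l) H (mkposreal eps He)).
Qed.

Lemma pow_n_Cpow (z : C) (k : nat) : @pow_n C_Ring z k = (z ^ k)%C.
Proof. induction k as [|k IH]; [reflexivity|]. simpl. rewrite IH. reflexivity. Qed.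

Lemma is_pseries_C (a : nat -> C) (z l : C) :
  @is_pseries C_AbsRing C_NormedModule a z l <->
  is_Cseries (fun k => (a k * z ^ k)%C) l.
Proof.
split; apply is_series_ext; intros k; [|symmetry];
  exact (eq_trans (f_equal (fun x => (x * a k)%C) (pow_n_Cpow z k)) (Cmult_comm _ _)).
Qed.

Lemma series_terms_eventually_bounded (a : nat -> C) (l : C) :
  is_Cseries a l ->
  exists N : nat, forall n, (N <= n)%nat -> Cmod (a n) <= 2.
Proof.
intros H. destruct (is_series_C_eps a l H 1 Rlt_0_1) as [N HN].
exists (S N). intros [|n] Hn; [lia|].
replace (a (S n)) with ((sum_n a (S n) - l) + - (sum_n a n - l))%C.
- eapply Rle_trans; [apply Cmod_triangle|]. rewrite Cmod_opp.
  assert (H1 := HN n ltac:(lia)). assert (H2 := HN (S n) ltac:(lia)). lra.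
- rewrite sum_Sn. change plus with Cplus. ring.
Qed.

(** Compare with a geometric series: at the larger radius [(1 + r) / 2] the
    terms are eventually bounded. *)
Lemma pseries_abs (a : nat -> C) (h : C -> C) (r : R) :
  disk_series a h -> 0 < r < 1 -> ex_series (fun n => Cmod (a n) * r ^ n).
Proof.
intros [_ H] Hr.
set (s := (1 + r) / 2).
assert (Hs : 0 < s < 1) by (unfold s; lra).
assert (Hsd : unit_disk s).
{ unfold unit_disk. rewrite Cmod_R, Rabs_pos_eq; lra. }
destruct (series_terms_eventually_bounded _ _ (proj1 (is_pseries_C _ _ _) (H s Hsd))) as [N HN].
apply (proj2 (ex_series_incr_n (fun n => Cmod (a n) * r ^ n) N)).
apply (ex_series_le (V := R_CompleteNormedModule) _ (fun k => 2 * (r / s) ^ (N + k))).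
- intros k. change norm with Rabs. rewrite Rabs_pos_eq.
  + specialize (HN (N + k)%nat ltac:(lia)).
    rewrite Cmod_mult, Cmod_pow, Cmod_R, Rabs_pos_eq in HN by lra.
    replace (r ^ (N + k)) with (s ^ (N + k) * (r / s) ^ (N + k)).
    * rewrite <- Rmult_assoc. apply Rmult_le_compat_r; [|assumption].
      apply pow_le. left; apply Rdiv_lt_0_compat; lra.
    * rewrite <- Rpow_mult_distr. f_equal. field. lra.
  + apply Rmult_le_pos; [apply Cmod_ge_0|apply pow_le; lra].
- apply (ex_series_scal (V := R_NormedModule) 2).
  apply (proj1 (ex_series_incr_n (fun k => (r / s) ^ k) N)).
  exists (/ (1 - r / s)). apply is_series_geom.
  rewrite Rabs_pos_eq.
  + apply Rlt_div_l; unfold s; lra.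
  + left; apply Rdiv_lt_0_compat; lra.
Qed.

(** The tails on the circle of radius [r] are dominated by those of the
    convergent series of [|a n| * r ^ n], whatever the argument of [z]. *)
Lemma disk_series_uniform (a : nat -> C) (h : C -> C) (r eps : R) :
  disk_series a h -> 0 < r < 1 -> 0 < eps ->
  exists N0 : nat, forall N z, (N0 <= N)%nat -> Cmod z = r ->
    Cmod (peval a N z - h z) <= eps.
Proof.
intros Ha Hr He.
destruct (pseries_abs a h r Ha Hr) as [l Hl].
assert (He4 : 0 < eps / 4) by lra.
destruct (proj1 (filterlim_locally_ball_norm _ _) Hl (mkposreal _ He4)) as [N0 HN0].
assert (HB : forall n, (N0 <= n)%nat ->
  Rabs (sum_n (fun n => Cmod (a n) * r ^ n) n - l) < eps / 4) by exact HN0.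
clear HN0. set (B := sum_n (fun n => Cmod (a n) * r ^ n)) in HB.
exists N0. intros N z HN Hz.
assert (Hd : unit_disk z) by (unfold unit_disk; lra).
assert (Hdiff : forall k, Cmod (peval a (N + k) z - peval a N z) <= B (N + k)%nat - B N).
{ induction k as [|k IH].
  - rewrite Nat.add_0_r. unfold Cminus. rewrite Cplus_opp_r, Cmod_0. lra.
  - rewrite Nat.add_succ_r. unfold peval, B in *. rewrite !sum_Sn.
    change (@plus C_AbelianMonoid) with Cplus. change plus with Rplus.
    match goal with |- Cmod (?x + ?t - ?y)%C <= _ =>
      replace (x + t - y)%C with ((x - y) + t)%C by ring end.
    eapply Rle_trans; [apply Cmod_triangle|].
    rewrite Cmod_mult, Cmod_pow, Hz. simpl in *. lra. }
destruct (is_series_C_eps _ _ (proj1 (is_pseries_C _ _ _) (proj2 Ha z Hd)) _ He4) as [N1 HN1].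
specialize (Hdiff N1). specialize (HN1 (N + N1)%nat ltac:(lia)).
fold (peval a (N + N1) z) in HN1.
replace (peval a N z - h z)%C
  with (- (peval a (N + N1) z - peval a N z) + (peval a (N + N1) z - h z))%C by ring.
eapply Rle_trans; [apply Cmod_triangle|]. rewrite Cmod_opp.
assert (H1 := HB N HN). assert (H2 := HB (N + N1)%nat ltac:(lia)).
apply Rabs_def2 in H1. apply Rabs_def2 in H2. lra.
Qed.

Lemma bernoulli_pow (d : R) (n : nat) : 0 <= d <= 1 -> 1 - INR n * d <= (1 - d) ^ n.
Proof.
intros Hd. induction n as [|n IH]; [simpl; lra|].
rewrite S_INR. simpl.
assert (0 <= INR n) by apply pos_INR. nra.
Qed.

(** For [h = z * k] with [|k| <= M] this is the classical coefficient bound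
    [M * |k_p| <= M ^ 2 - |k_0| ^ 2] with [p = n - 1]. The partial sums of [h]
    on the circle of radius [r] are polynomials bounded by [M + eps], to which
    the polynomial inequality applies; then [eps] tends to 0 and [r] to 1. *)
Lemma bounded_series_coef (a : nat -> C) (h : C -> C) (M : R) (n : nat) :
  0 < M -> disk_series a h -> (forall z, unit_disk z -> Cmod (h z) <= M) ->
  (2 <= n)%nat -> M * Cmod (a n) + Cmod (a 1%nat) ^ 2 <= M ^ 2.
Proof.
intros HM Ha Hb Hn.
assert (Hn0 := Cmod_ge_0 (a n)). assert (Ha1 := Cmod_ge_0 (a 1%nat)).
assert (Hreps : forall r eps, 0 < r < 1 -> 0 < eps ->
  (M + eps) * (Cmod (a n) * r ^ n) + (Cmod (a 1%nat) * r) ^ 2 <= (M + eps) ^ 2).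
{ intros r eps Hr He.
  destruct (disk_series_uniform a h r eps Ha Hr He) as [N0 HN0].
  set (N := (N0 + n)%nat).
  (* the truncated series of z |-> h (r z) *)
  set (c := fun m => if (m <=? N)%nat then (a m * r ^ m)%C else RtoC 0).
  assert (Hcr : forall m, (m <= N)%nat -> Cmod (c m) = Cmod (a m) * r ^ m).
  { intros m Hm. unfold c. destruct (Nat.leb_spec m N); [|lia].
    rewrite Cmod_mult, Cmod_pow, Cmod_R, Rabs_pos_eq; lra. }
  rewrite <- (Hcr n) by (unfold N; lia).
  replace (Cmod (a 1%nat) * r) with (Cmod (c 1%nat)) by (rewrite Hcr by (unfold N; lia); simpl; ring).
  apply toeplitz_bound; [lra|]. intros al be.
  replace n with (S (n - 1)) by lia.
  apply (poly_bessel c N); try (unfold N; lia).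
  - unfold c. simpl. rewrite (proj1 Ha). ring.
  - intros m Hm. unfold c. destruct (Nat.leb_spec m N); [lia|reflexivity].
  - intros z Hz.
    assert (Hrz : Cmod (r * z) = r).
    { rewrite Cmod_mult, Hz, Cmod_R, Rabs_pos_eq; lra. }
    replace (peval c N z) with (h (r * z) + (peval a N (r * z) - h (r * z)))%C.
    + eapply Rle_trans; [apply Cmod_triangle|]. apply Rplus_le_compat.
      * apply Hb. unfold unit_disk. lra.
      * apply HN0; [unfold N; lia|exact Hrz].
    + transitivity (peval a N (r * z)); [ring|].
      apply sum_n_ext_loc; intros m Hm. unfold c.
      destruct (Nat.leb_spec m N); [|lia]. rewrite Cpow_mult_l. ceq. ring. }
assert (Hr : forall r, 0 < r < 1 ->
  M * (Cmod (a n) * r ^ n) + (Cmod (a 1%nat) * r) ^ 2 <= M ^ 2).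
{ intros r Hr.
  apply Rnot_lt_le; intros Hlt.
  set (x := Cmod (a n) * r ^ n) in *. set (y := (Cmod (a 1%nat) * r) ^ 2) in *.
  assert (Hx : 0 <= x) by (apply Rmult_le_pos; [apply Cmod_ge_0|apply pow_le; lra]).
  set (T := M * x + y - M ^ 2).
  assert (HT : 0 < T) by (unfold T; lra).
  (* eps < 1 and (2 M + 1) eps < T, hence 2 M eps + eps^2 < T *)
set (eps := T / (2 * M + 1 + T)).
  assert (He : 0 < eps) by (apply Rdiv_lt_0_compat; lra).
  assert (He1 : eps < 1) by (apply Rlt_div_l; lra).
  assert (He2 : eps * (2 * M + 1 + T) = T) by (unfold eps; field; lra).
  specialize (Hreps r eps Hr He). fold x y in Hreps.
  unfold T in *. nra. }
apply Rnot_lt_le; intros Hlt.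
set (X := M * Cmod (a n) + Cmod (a 1%nat) ^ 2) in *.
assert (HX : 0 < X) by (assert (0 < M ^ 2) by (apply pow_lt; lra); lra).
assert (Hin : 2 <= INR n) by (apply (le_INR 2); lia).
(* a radius 1 - d so close to 1 that Bernoulli gives X (1 - d)^n > M^2 *)
set (d := (X - M ^ 2) / (2 * INR n * X)).
assert (HnX : 0 < 2 * INR n * X) by nra.
assert (Hd : 0 < d) by (apply Rdiv_lt_0_compat; lra).
assert (Hd1 : d < 1).
{ apply Rlt_div_l; [lra|]. assert (0 < M ^ 2) by (apply pow_lt; lra). nra. }
assert (Hd2 : d * (2 * INR n * X) = X - M ^ 2) by (unfold d; field; lra).
specialize (Hr (1 - d) ltac:(lra)).
assert (Hle : X * (1 - d) ^ n <= M ^ 2).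
{ eapply Rle_trans; [|exact Hr]. unfold X.
  rewrite Rpow_mult_distr, Rmult_plus_distr_r, Rmult_assoc.
  apply Rplus_le_compat_l, Rmult_le_compat_l; [apply pow2_ge_0|].
  replace n with (2 + (n - 2))%nat by lia. rewrite pow_add.
  rewrite <- (Rmult_1_r ((1 - d) ^ 2)) at 2.
  apply Rmult_le_compat_l; [apply pow2_ge_0|].
  apply (Rle_trans _ (1 ^ (n - 2))); [apply pow_incr; lra|rewrite pow1; lra]. }
assert (HB := bernoulli_pow d n ltac:(lra)).
assert (X * (1 - INR n * d) <= X * (1 - d) ^ n) by (apply Rmult_le_compat_l; lra).
nra.
Qed.

(** * The derivatives at the origin and the coefficient estimate *)

Lemma Re_sum_n (a : nat -> C) (n : nat) : Re (sum_n a n)%C = sum_n (fun m => Re (a m)%C) n.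
Proof.
induction n as [|n IH]; [now rewrite !sum_O|].
rewrite !sum_Sn, <- IH. reflexivity.
Qed.

Lemma is_series_Re (a : nat -> C) (l : C) :
  is_Cseries a l ->
  @is_series R_AbsRing R_NormedModule (fun n => Re (a n)%C) (Re l).
Proof.
intros H. apply (proj2 (filterlim_locally_ball_norm _ _)). intros [eps He].
destruct (is_series_C_eps a l H eps He) as [N HN].
exists N. intros n Hn. unfold ball_norm. simpl.
rewrite <- Re_sum_n.
eapply Rle_lt_trans; [|exact (HN n Hn)].
apply (re_le_Cmod (sum_n a n - l)).
Qed.

(** Along the line spanned by [zeta] the real part of [kappa * h] is a real power
    series in [t], so its derivative at 0 is its coefficient of index 1. The
    factor [kappa] gives access to imaginary parts as well, since
    [Im w = Re (- Ci * w)]. *)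
Lemma is_derive_disk_series_0 (a : nat -> C) (h : C -> C) (zeta kappa : C) :
  disk_series a h -> Cmod zeta = 1 ->
  @is_derive R_AbsRing R_NormedModule (fun t : R => Re (kappa * h (t * zeta))%C) 0
    (Re (kappa * (a 1%nat * zeta))%C).
Proof.
intros Ha Hz.
set (c := fun n => Re (kappa * (a n * zeta ^ n))%C).
apply (is_derive_ext_loc (PSeries c)).
- exists (mkposreal 1 Rlt_0_1). intros t Ht.
  change (Rabs (t - 0) < 1) in Ht. rewrite Rminus_0_r in Ht.
  apply is_pseries_unique.
  assert (Hd : unit_disk (t * zeta)).
  { unfold unit_disk. rewrite Cmod_mult, Hz, Cmod_R. lra. }
  assert (H := proj1 (is_pseries_C _ _ _) (proj2 Ha _ Hd)).
  apply (is_series_scal kappa) in H. apply is_series_Re in H.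
  revert H. apply is_series_ext. intros n.
  change (Re (kappa * (a n * (t * zeta) ^ n))%C = pow_n t n * c n).
  rewrite pow_n_pow, Cpow_mult_l, <- RtoC_pow. unfold c.
  destruct (zeta ^ n)%C, (a n), kappa. simpl. ring.
- replace (Re (kappa * (a 1%nat * zeta))%C) with (PSeries (PS_derive c) 0).
  + apply is_derive_PSeries. rewrite Rabs_R0.
    apply (Rbar_lt_le_trans _ (1 / 2)); [simpl; lra|].
    apply (proj1 (Lub_Rbar_correct (CV_disk c))).
    unfold CV_disk.
    apply (ex_series_le (V := R_CompleteNormedModule) _
      (fun n => Cmod kappa * (Cmod (a n) * (1 / 2) ^ n))).
    * intros n. change norm with Rabs. rewrite Rabs_Rabsolu, Rabs_mult.
      rewrite (Rabs_pos_eq ((1 / 2) ^ n)) by (apply pow_le; lra).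
      rewrite <- Rmult_assoc. apply Rmult_le_compat_r; [apply pow_le; lra|].
      eapply Rle_trans; [apply re_le_Cmod|].
      rewrite !Cmod_mult, Cmod_pow, Hz, pow1. lra.
    * apply (ex_series_scal (V := R_NormedModule) (Cmod kappa)).
      apply (pseries_abs a h); [assumption|lra].
  + rewrite PSeries_0. unfold PS_derive, c. simpl INR.
    rewrite Rmult_1_l, Cpow_1_r. reflexivity.
Qed.

Lemma Derive_harmonic_pair_0 (f h g : C -> C) (a b : nat -> C) (zeta : C) :
  (forall z : C, unit_disk z -> f z = (h z + Cconj (g z))%C) ->
  disk_series a h -> disk_series b g -> Cmod zeta = 1 ->
  Derive (fun t : R => Re (f (t * zeta)%C)%C) 0 = Re (a 1%nat * zeta)%C + Re (b 1%nat * zeta)%C /\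
  Derive (fun t : R => Im (f (t * zeta)%C)%C) 0 = Im (a 1%nat * zeta)%C - Im (b 1%nat * zeta)%C.
Proof.
intros Hf Ha Hb Hz.
assert (Hloc : forall (phi : C -> R) (psi : R -> R),
  (forall t : R, phi (h (t * zeta) + Cconj (g (t * zeta)))%C = psi t) ->
  locally 0 (fun t : R => psi t = phi (f (t * zeta)%C))).
{ intros phi psi H. exists (mkposreal 1 Rlt_0_1). intros t Ht.
  change (Rabs (t - 0) < 1) in Ht. rewrite Rminus_0_r in Ht.
  rewrite Hf, H; [reflexivity|].
  unfold unit_disk. rewrite Cmod_mult, Hz, Cmod_R. lra. }
split; apply is_derive_unique.
- eapply is_derive_ext_loc; [apply Hloc|].
  + intros t. exact (eq_refl _).
  + apply (is_derive_ext (fun t : R => Re (1 * h (t * zeta))%C + Re (1 * g (t * zeta))%C)).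
    * intros t. destruct (h (t * zeta)%C), (g (t * zeta)%C). simpl. ring.
    * rewrite <- (Cmult_1_l (a 1%nat * zeta)), <- (Cmult_1_l (b 1%nat * zeta)).
      apply (is_derive_plus (V := R_NormedModule)); apply is_derive_disk_series_0; assumption.
- eapply is_derive_ext_loc; [apply Hloc|].
  + intros t. exact (eq_refl _).
  + apply (is_derive_ext (fun t : R => Re (- Ci * h (t * zeta))%C + Re (Ci * g (t * zeta))%C)).
    * intros t. destruct (h (t * zeta)%C), (g (t * zeta)%C). simpl. ring.
    * replace (Im (a 1%nat * zeta)%C - Im (b 1%nat * zeta)%C)
        with (Re (- Ci * (a 1%nat * zeta))%C + Re (Ci * (b 1%nat * zeta))%C).
      -- apply (is_derive_plus (V := R_NormedModule)); apply is_derive_disk_series_0; assumption.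
      -- destruct (a 1%nat * zeta)%C, (b 1%nat * zeta)%C. simpl. ring.
Qed.

(** The partial derivatives at 0 combine to [dz f 0 = a 1] and
    [dzbar f 0 = Cconj (b 1)]. *)
Lemma lambda_harmonic_pair_0 (f h g : C -> C) (a b : nat -> C) :
  (forall z : C, unit_disk z -> f z = (h z + Cconj (g z))%C) ->
  disk_series a h -> disk_series b g ->
  lambda f 0 = Rabs (Cmod (a 1%nat) - Cmod (b 1%nat)).
Proof.
intros Hf Ha Hb.
destruct (Derive_harmonic_pair_0 f h g a b 1 Hf Ha Hb Cmod_1) as [X1 X2].
destruct (Derive_harmonic_pair_0 f h g a b Ci Hf Ha Hb Cmod_Ci) as [Y1 Y2].
assert (Hx : dx f 0 = (Re (a 1%nat * 1)%C + Re (b 1%nat * 1)%C, Im (a 1%nat * 1)%C - Im (b 1%nat * 1)%C)).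
{ unfold dx. rewrite <- X1, <- X2. f_equal; apply Derive_ext; intros t;
  do 2 f_equal; unfold Cmult, RtoC, Im; simpl; f_equal; ring. }
assert (Hy : dy f 0 = (Re (a 1%nat * Ci)%C + Re (b 1%nat * Ci)%C, Im (a 1%nat * Ci)%C - Im (b 1%nat * Ci)%C)).
{ unfold dy. rewrite <- Y1, <- Y2. f_equal; apply Derive_ext; intros t;
  do 2 f_equal; unfold Cmult, RtoC, Im; simpl; f_equal; ring. }
unfold lambda. do 2 f_equal.
- f_equal. unfold dz. rewrite Hx, Hy. destruct (a 1%nat), (b 1%nat).
  apply injective_projections; simpl; field.
- rewrite <- Cmod_conj. f_equal. unfold dzbar. rewrite Hx, Hy. destruct (a 1%nat), (b 1%nat).
  apply injective_projections; simpl; field.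
Qed.

(** For every [u] of modulus one [h + u * g] is analytic and bounded by [M], with
    first coefficient of modulus at least [| |a 1| - |b 1| | = 1]. Choosing [u] so
    that [a n] and [u * b n] are aligned makes its coefficient of index [n] equal
    to [|a n| + |b n|] in modulus. *)
Lemma coef_estimate (M : R) (f h g : C -> C) (a b : nat -> C) :
  0 < M -> bounded_harmonic_pair M f h g a b ->
  1 <= M /\
  forall n : nat, (2 <= n)%nat -> Cmod (a n) + Cmod (b n) <= M - 1 / M.
Proof.
intros HM [_ Hf Ha Hb Hbd Hl].
rewrite (lambda_harmonic_pair_0 f h g a b Hf Ha Hb) in Hl.
assert (Hmain : forall n : nat, (2 <= n)%nat -> M * (Cmod (a n) + Cmod (b n)) + 1 <= M ^ 2).
{ intros n Hn.
  destruct (phase_exists (a n) (b n)) as [u [Hu Hs]].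
  set (A := fun m => (a m + u * b m)%C).
  assert (HA : disk_series A (fun z => h z + u * g z)%C).
  { split.
    - unfold A. rewrite (proj1 Ha), (proj1 Hb). ring.
    - intros z Hz. apply is_pseries_C.
      assert (H1 := proj1 (is_pseries_C _ _ _) (proj2 Ha z Hz)).
      assert (H2 := proj1 (is_pseries_C _ _ _) (proj2 Hb z Hz)).
      apply (is_series_scal u) in H2.
      assert (H3 := is_series_plus _ _ _ _ H1 H2). revert H3.
      apply is_series_ext. intros m. unfold A.
      change (a m * z ^ m + u * (b m * z ^ m) = (a m + u * b m) * z ^ m)%C. ring. }
  assert (HAb : forall z, unit_disk z -> Cmod (h z + u * g z)%C <= M).
  { intros z Hz. eapply Rle_trans; [apply Cmod_triangle|].
    rewrite Cmod_mult, Hu, Rmult_1_l. apply Hbd, Hz. }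
  assert (H := bounded_series_coef A _ M n HM HA HAb Hn).
  unfold A in H at 1. rewrite Hs in H.
  assert (H1 : 1 <= Cmod (A 1%nat)).
  { rewrite <- Hl. unfold A.
    assert (T1 := Cmod_triangle (a 1%nat + u * b 1%nat) (- (u * b 1%nat))).
    assert (T2 := Cmod_triangle (a 1%nat + u * b 1%nat) (- a 1%nat)).
    rewrite !Cmod_opp in T1, T2.
    replace (a 1%nat + u * b 1%nat + - (u * b 1%nat))%C with (a 1%nat) in T1 by ring.
    replace (a 1%nat + u * b 1%nat + - a 1%nat)%C with (u * b 1%nat)%C in T2 by ring.
    rewrite Cmod_mult, Hu, Rmult_1_l in T1, T2.
    apply Rabs_le. lra. }
  nra. }
split.
- assert (H := Hmain 2%nat ltac:(lia)).
  assert (0 <= Cmod (a 2%nat)) by apply Cmod_ge_0.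
  assert (0 <= Cmod (b 2%nat)) by apply Cmod_ge_0. nra.
- intros n Hn. specialize (Hmain n Hn).
  apply (Rmult_le_reg_l M); [assumption|].
  replace (M * (M - 1 / M)) with (M ^ 2 - 1) by (field; lra). lra.
Qed.

(** * Real parts of holomorphic functions are harmonic *)

(** The uniform structure on [C] is here the one of the modulus, for which the
    product and chain rules hold over any absolute-value ring; the structure
    carried by [C_NormedModule] is the equivalent product one. *)
Definition is_Cderive (F : C -> C) (z l : C) : Prop :=
  @is_derive C_AbsRing (AbsRing_NormedModule C_AbsRing) F z l.

Lemma is_Cderive_eps (F : C -> C) (z l : C) : is_Cderive F z l ->
  forall eps, 0 < eps -> exists d, 0 < d /\ forall w, Cmod (w - z) < d ->
    Cmod (F w - F z - (w - z) * l) <= eps * Cmod (w - z).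
Proof.
intros [_ H] eps He.
destruct (H z (fun P HP => HP) (mkposreal eps He)) as [d Hd].
exists d. split; [apply cond_pos|]. intros w Hw. exact (Hd w Hw).
Qed.

Lemma is_Cderive_of_eps (F : C -> C) (z l : C) :
  (forall eps, 0 < eps -> exists d, 0 < d /\ forall w, Cmod (w - z) < d ->
    Cmod (F w - F z - (w - z) * l) <= eps * Cmod (w - z)) ->
  is_Cderive F z l.
Proof.
intros H. split.
- apply (is_linear_scal_l (V := AbsRing_NormedModule C_AbsRing)).
- intros z' Hz'. 
  assert (E := is_filter_lim_locally_unique (V := AbsRing_NormedModule C_AbsRing) _ _ Hz').
  rewrite <- E. intros [eps He]. destruct (H eps He) as [d [Hd Hw]].
  exists (mkposreal d Hd). intros w. apply Hw.
Qed.

(** Restriction of the derivative to a line with direction [zeta]; the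
    directions [1] and [Ci] give the partial derivatives, and with them the
    Cauchy-Riemann equations. *)
Lemma is_derive_Re_line (F : C -> C) (l zeta : C) (t0 : R) (gam : R -> C) :
  is_Cderive F (gam t0) l -> Cmod zeta = 1 ->
  (forall t, gam t - gam t0 = RtoC (t - t0)%R * zeta)%C ->
  @is_derive R_AbsRing R_NormedModule (fun t => Re (F (gam t))) t0 (Re (zeta * l)%C).
Proof.
intros H Hz Hg. split.
- apply (is_linear_scal_l (V := R_NormedModule)).
- intros t' Ht'.
  assert (E := is_filter_lim_locally_unique (V := R_NormedModule) _ _ Ht').
  rewrite <- E. intros [eps He].
  destruct (is_Cderive_eps _ _ _ H eps He) as [d [Hd Hw]].
  exists (mkposreal d Hd). intros t Ht.
  change (Rabs (t - t0) < d) in Ht.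
  change (Rabs (Re (F (gam t)) - Re (F (gam t0)) - (t - t0) * Re (zeta * l)%C)
    <= eps * Rabs (t - t0)).
  assert (Hm : Cmod (gam t - gam t0) = Rabs (t - t0)).
  { rewrite Hg, Cmod_mult, Hz, Cmod_R. ring. }
  specialize (Hw (gam t)). rewrite Hm in Hw.
  eapply Rle_trans; [|apply Hw; exact Ht].
  eapply Rle_trans; [|apply re_le_Cmod]. right. f_equal.
  rewrite Hg. destruct (F (gam t)), (F (gam t0)), zeta, l. simpl. ring.
Qed.

Definition Ccontinuous (F : C -> C) (z : C) : Prop :=
  forall eps, 0 < eps -> exists d, 0 < d /\ forall w, Cmod (w - z) < d ->
    Cmod (F w - F z) < eps.

Lemma Ccontinuous_scal (k : C) (F : C -> C) (z : C) :
  Ccontinuous F z -> Ccontinuous (fun w => k * F w)%C z.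
Proof.
intros H eps He. assert (Hk := Cmod_ge_0 k).
destruct (H (eps / (Cmod k + 1))) as [d [Hd Hw]].
{ apply Rdiv_lt_0_compat; lra. }
exists d. split; [exact Hd|]. intros w Hwz. specialize (Hw w Hwz).
replace (k * F w - k * F z)%C with (k * (F w - F z))%C by ring.
rewrite Cmod_mult. assert (H0 := Cmod_ge_0 (F w - F z)).
apply Rlt_div_r in Hw; [nra|lra].
Qed.

Lemma is_Cderive_continuous (F : C -> C) (z l : C) : is_Cderive F z l -> Ccontinuous F z.
Proof.
intros H eps He.
assert (Hc : continuous (T := AbsRing_UniformSpace C_AbsRing) (U := AbsRing_UniformSpace C_AbsRing) F z).
{ apply (ex_derive_continuous (V := AbsRing_NormedModule C_AbsRing)). exists l. exact H. }
destruct (proj1 (filterlim_locally _ _) Hc (mkposreal eps He)) as [d Hd].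
exists d. split; [apply cond_pos|]. intros w Hw. exact (Hd w Hw).
Qed.

Lemma Cmod_pair_lt (z : C) (x y d : R) :
  Rabs (Re z - x) < d / 2 -> Rabs (Im z - y) < d / 2 -> Cmod (z - (x, y)) < d.
Proof.
intros H1 H2. destruct z as [u v]. simpl in *.
replace ((u, v) - (x, y))%C with (RtoC (u - x)%R + RtoC (v - y)%R * Ci)%C.
- eapply Rle_lt_trans; [apply Cmod_triangle|].
  rewrite Cmod_mult, Cmod_Ci, !Cmod_R. lra.
- apply injective_projections; simpl; ring.
Qed.

Lemma Ccontinuous_continuity_2d (F : C -> C) (x y : R) :
  Ccontinuous F (x, y) -> continuity_2d_pt (fun u v => Re (F (u, v))) x y.
Proof.
intros H [eps He]. destruct (H eps He) as [d [Hd Hw]].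
assert (Hd2 : 0 < d / 2) by lra.
exists (mkposreal _ Hd2). simpl. intros u v Hu Hv.
eapply Rle_lt_trans; [|apply (Hw (u, v))].
- apply (re_le_Cmod (F (u, v) - F (x, y))).
- apply Cmod_pair_lt; assumption.
Qed.

Lemma unit_disk_open (x y : R) : unit_disk (x, y) ->
  locally_2d (fun u v => unit_disk (u, v)) x y.
Proof.
unfold unit_disk. intros H. set (d := (1 - Cmod (x, y)) / 2).
assert (Hd : 0 < d) by (unfold d; lra).
exists (mkposreal d Hd). simpl. intros u v Hu Hv.
replace ((u, v) : C) with ((x, y) + ((u, v) - (x, y)))%C by ring.
eapply Rle_lt_trans; [apply Cmod_triangle|].
assert (Cmod ((u, v) - (x, y)) < 2 * d).
{ apply Cmod_pair_lt; simpl; lra. }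
unfold d in *; lra.
Qed.

Lemma is_derive_Re_x (F F1 : C -> C) (x y : R) :
  (forall z, unit_disk z -> is_Cderive F z (F1 z)) -> unit_disk (x, y) ->
  @is_derive R_AbsRing R_NormedModule (fun t => Re (F (t, y))) x (Re (F1 (x, y))).
Proof.
intros HF Hz. rewrite <- (Cmult_1_l (F1 (x, y))).
apply (is_derive_Re_line F (F1 (x, y)) 1 x (fun t => (t, y))).
- apply HF, Hz.
- apply Cmod_1.
- intros t. apply injective_projections; simpl; ring.
Qed.

Lemma is_derive_Re_y (F F1 : C -> C) (x y : R) :
  (forall z, unit_disk z -> is_Cderive F z (F1 z)) -> unit_disk (x, y) ->
  @is_derive R_AbsRing R_NormedModule (fun t => Re (F (x, t))) y (Re (Ci * F1 (x, y))%C).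
Proof.
intros HF Hz.
apply (is_derive_Re_line F (F1 (x, y)) Ci y (fun t => (x, t))).
- apply HF, Hz.
- apply Cmod_Ci.
- intros t. apply injective_projections; simpl; ring.
Qed.

Lemma is_Cderive_mult (F G : C -> C) (z l m : C) :
  is_Cderive F z l -> is_Cderive G z m ->
  is_Cderive (fun w => F w * G w)%C z (l * G z + F z * m)%C.
Proof. intros HF HG. apply (is_derive_mult F G z l m HF HG). apply Cmult_comm. Qed.

Lemma is_Cderive_plus (F G : C -> C) (z l m : C) :
  is_Cderive F z l -> is_Cderive G z m ->
  is_Cderive (fun w => F w + G w)%C z (l + m)%C.
Proof. intros HF HG. apply (is_derive_plus (V := AbsRing_NormedModule C_AbsRing) F G z l m HF HG). Qed.

Lemma is_Cderive_const (k z : C) : is_Cderive (fun _ => k) z 0.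
Proof. apply (is_derive_const (V := AbsRing_NormedModule C_AbsRing)). Qed.

Lemma is_Cderive_id (z : C) : is_Cderive (fun w => w) z 1.
Proof. apply (is_derive_id (K := C_AbsRing)). Qed.

Lemma is_Cderive_scal (k : C) (F : C -> C) (z l : C) :
  is_Cderive F z l -> is_Cderive (fun w => k * F w)%C z (k * l)%C.
Proof.
intros H. replace (k * l)%C with (0 * F z + k * l)%C by ring.
apply (is_Cderive_mult (fun _ => k)); [apply is_Cderive_const|exact H].
Qed.

(** By Cauchy-Riemann the partial derivatives of [Re G0] are the real parts of
    [G1] and [Ci * G1], and multiplying the whole sequence of derivatives by
    [Ci] gives another such sequence; this is what makes the induction close. *)
Lemma ex_diff_n_Re (n : nat) : forall G : nat -> C -> C,
  (forall k z, (k < n)%nat -> unit_disk z -> is_Cderive (G k) z (G (S k) z)) ->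
  (forall z, unit_disk z -> Ccontinuous (G n) z) ->
  forall x y, unit_disk (x, y) -> ex_diff_n (fun u v => Re (G 0%nat (u, v))) n x y.
Proof.
induction n as [|n IH]; intros G HG Hc x y Hz.
- split; [|exact I]. apply Ccontinuous_continuity_2d, Hc, Hz.
- assert (H0 : forall z, unit_disk z -> is_Cderive (G 0%nat) z (G 1%nat z)).
  { intros z. apply HG. lia. }
  destruct (unit_disk_open x y Hz) as [d Hd].
  split; [|split; [|split; [|split]]].
  + apply Ccontinuous_continuity_2d. eapply is_Cderive_continuous, H0, Hz.
  + eexists. apply (is_derive_Re_x _ _ _ _ H0), Hz.
  + eexists. apply (is_derive_Re_y _ _ _ _ H0), Hz.
  + apply (ex_diff_n_ext_loc (fun u v => Re (G 1%nat (u, v)))).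
    * exists d. intros u v Hu Hv. symmetry. apply is_derive_unique.
      apply (is_derive_Re_x _ _ _ _ H0), Hd; assumption.
    * apply (IH (fun k => G (S k))); [|exact Hc|exact Hz].
      intros k z Hk. apply HG. lia.
  + apply (ex_diff_n_ext_loc (fun u v => Re (Ci * G 1%nat (u, v))%C)).
    * exists d. intros u v Hu Hv. symmetry. apply is_derive_unique.
      apply (is_derive_Re_y _ _ _ _ H0), Hd; assumption.
    * apply (IH (fun k z => Ci * G (S k) z)%C); [| |exact Hz].
      -- intros k z Hk Hz'. apply is_Cderive_scal, HG; [lia|exact Hz'].
      -- intros z Hz'. apply Ccontinuous_scal, Hc, Hz'.
Qed.

(** The second derivatives in [x] and [y] are [Re F2] and
    [Re (Ci * (Ci * F2)) = - Re F2]. *)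
Lemma Re_holomorphic_harmonic (F F1 F2 : C -> C) :
  (forall z, unit_disk z -> is_Cderive F z (F1 z)) ->
  (forall z, unit_disk z -> is_Cderive F1 z (F2 z)) ->
  (forall z, unit_disk z -> Ccontinuous F2 z) ->
  real_harmonic_on unit_disk (fun x y => Re (F (x, y))).
Proof.
intros H1 H2 H3 x y Hz. split.
- apply (ex_diff_n_Re 2 (fun k => match k with 0%nat => F | 1%nat => F1 | _ => F2 end));
    [|exact H3|exact Hz].
  intros [|[|k]] z Hk Hz'; [apply H1, Hz'|apply H2, Hz'|lia].
- destruct (unit_disk_open x y Hz) as [d Hd].
  assert (Hloc : forall t, Rabs (t - x) < d -> unit_disk (t, y)).
  { intros t Ht. apply Hd; [exact Ht|]. rewrite Rminus_diag, Rabs_R0. apply cond_pos. }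
  assert (Hloc' : forall t, Rabs (t - y) < d -> unit_disk (x, t)).
  { intros t Ht. apply Hd; [|exact Ht]. rewrite Rminus_diag, Rabs_R0. apply cond_pos. }
  unfold partial_derive. simpl.
  rewrite (Derive_ext_loc _ (fun t => Re (F1 (t, y))) x).
  2: { exists d. intros t Ht. apply is_derive_unique, (is_derive_Re_x _ _ _ _ H1), Hloc, Ht. }
  rewrite (Derive_ext_loc _ (fun t => Re (Ci * F1 (x, t))%C) y).
  2: { exists d. intros t Ht. apply is_derive_unique, (is_derive_Re_y _ _ _ _ H1), Hloc', Ht. }
  assert (HC : forall z, unit_disk z -> is_Cderive (fun w => Ci * F1 w)%C z (Ci * F2 z)%C).
  { intros z Hz'. apply is_Cderive_scal, H2, Hz'. }
  transitivity (Re (F2 (x, y)) + Re (Ci * (Ci * F2 (x, y)))%C).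
  + apply f_equal2; apply is_derive_unique;
      [apply (is_derive_Re_x _ _ _ _ H2) | apply (is_derive_Re_y _ _ _ _ HC)]; exact Hz.
  + destruct (F2 (x, y)). simpl. ring.
Qed.

(** * The extremal functions *)

Lemma is_Cderive_pow (n : nat) (z : C) :
  is_Cderive (fun w => w ^ n)%C z (INR n * z ^ pred n)%C.
Proof.
induction n as [|n IH].
- replace (INR 0 * z ^ pred 0)%C with (RtoC 0) by (simpl; ring). exact (is_Cderive_const 1 z).
- replace (INR (S n) * z ^ pred (S n))%C with (1 * z ^ n + z * (INR n * z ^ pred n))%C.
  + apply (is_Cderive_mult (fun w => w) (fun w => w ^ n)%C); [apply is_Cderive_id|exact IH].
  + rewrite S_INR, RtoC_plus. destruct n; simpl; ring.
Qed.

Lemma is_Cderive_inv (z : C) : z <> 0 -> is_Cderive Cinv z (- / (z * z))%C.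
Proof.
intros Hz. apply is_Cderive_of_eps. intros eps He.
assert (Hm := proj1 (Cmod_gt_0 z) Hz). set (m := Cmod z) in *.
set (k := eps * m ^ 3 / 2).
assert (Hk : 0 < k).
{ assert (0 < m ^ 3) by (apply pow_lt; exact Hm). unfold k. nra. }
exists (Rmin (m / 2) k). split; [apply Rmin_pos; lra|].
intros w Hw.
assert (Hw1 : Cmod (w - z) < m / 2) by (eapply Rlt_le_trans; [exact Hw|apply Rmin_l]).
assert (Hw2 : Cmod (w - z) < k) by (eapply Rlt_le_trans; [exact Hw|apply Rmin_r]).
assert (Hwm : m / 2 < Cmod w).
{ assert (T := Cmod_triangle w (- (w - z))). rewrite Cmod_opp in T.
  replace (w + - (w - z))%C with z in T by ring. fold m in T. lra. }
assert (Hw0 : w <> 0) by (apply Cmod_gt_0; lra).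
replace (/ w - / z - (w - z) * - / (z * z))%C
  with ((w - z) * ((w - z) * / (w * (z * z))))%C by (field; split; assumption).
assert (Hzz : (w * (z * z))%C <> 0) by (repeat apply Cmult_neq_0; assumption).
rewrite !Cmod_mult, Cmod_inv, !Cmod_mult by exact Hzz. fold m.
rewrite (Rmult_comm eps). apply Rmult_le_compat_l; [apply Cmod_ge_0|].
assert (Hmm : 0 < m * m) by nra.
apply Rle_div_l; [nra|].
apply (Rle_trans _ k); [lra|]. unfold k.
replace (eps * m ^ 3 / 2) with (eps * (m / 2 * (m * m))) by field.
apply Rmult_le_compat_l; [lra|]. apply Rmult_le_compat_r; lra.
Qed.

Lemma is_Cderive_ext_disk (F G : C -> C) (z l : C) :
  (forall w, unit_disk w -> F w = G w) -> unit_disk z ->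
  is_Cderive F z l -> is_Cderive G z l.
Proof.
intros E Hz. apply (is_derive_ext_loc (V := AbsRing_NormedModule C_AbsRing)).
unfold unit_disk in *.
assert (Hd : 0 < 1 - Cmod z) by lra.
exists (mkposreal _ Hd). intros w Hw. change (Cmod (w - z) < 1 - Cmod z) in Hw.
apply E. replace w with (z + (w - z))%C by ring.
eapply Rle_lt_trans; [apply Cmod_triangle|]. lra.
Qed.

Lemma is_series_C_unique (a : nat -> C) (l m : C) :
  is_Cseries a l ->
  is_Cseries a m -> l = m.
Proof.
intros Hl Hm.
exact (filterlim_locally_unique (V := C_NormedModule) (F := eventually) (sum_n a) l m Hl Hm).
Qed.

(** With [p = n - 1] the extremal function is
    [M ^ 2 * z + (M - M ^ 3) * z / (M - z ^ p)], from which its derivatives and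
    its power series are read off. *)
Section Extremal.
Variables (M : R) (p : nat).
Hypothesis HM : 1 <= M.
Hypothesis Hp : (1 <= p)%nat.

Let v (z : C) : C := (/ (M - z ^ p))%C.
Let K : C := RtoC (M - M ^ 3).

Lemma Cmod_pow_disk (z : C) : unit_disk z -> Cmod (z ^ p)%C < 1.
Proof.
intros Hz. rewrite Cmod_pow. apply pow_lt_1_compat; [|lia].
split; [apply Cmod_ge_0|exact Hz].
Qed.

Lemma denominator_nz (z : C) : unit_disk z -> (M - z ^ p <> 0)%C.
Proof.
intros Hz E. assert (H := Cmod_pow_disk z Hz).
assert (E' : (z ^ p)%C = RtoC M) by (transitivity (M - (M - z ^ p))%C; [ring|rewrite E; ring]).
rewrite E', Cmod_R, Rabs_pos_eq in H; lra.
Qed.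

Lemma f1_partial_fraction (z : C) : unit_disk z ->
  f1 M (S p) z = (M ^ 2 * z + K * (z * v z))%C.
Proof.
intros Hz. unfold f1, v, K. replace (S p - 1)%nat with p by lia.
assert (H := denominator_nz z Hz).
rewrite RtoC_minus, RtoC_pow. field. exact H.
Qed.

Lemma is_Cderive_v (z : C) : unit_disk z ->
  is_Cderive v z (INR p * z ^ pred p * (v z * v z))%C.
Proof.
intros Hz. assert (H := denominator_nz z Hz).
assert (Hd : is_Cderive (fun w => M + (-1) * w ^ p)%C z (0 + (-1) * (INR p * z ^ pred p))%C).
{ apply (is_Cderive_plus (fun _ => RtoC M)); [apply is_Cderive_const|].
  apply (is_Cderive_scal (-1)), is_Cderive_pow. }
assert (E : forall w, (M + (-1) * w ^ p = M - w ^ p)%C) by (intros; ring).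
assert (Hi := is_Cderive_inv (M + (-1) * z ^ p)%C).
rewrite E in Hi at 1. specialize (Hi H).
assert (Hc := is_derive_comp (V := AbsRing_NormedModule C_AbsRing) Cinv
   (fun w => M + (-1) * w ^ p)%C z _ _ Hi Hd).
apply (is_derive_ext (V := AbsRing_NormedModule C_AbsRing) _ v) in Hc.
- match type of Hc with is_derive _ _ ?l => replace (INR p * z ^ pred p * (v z * v z))%C with l end.
  + exact Hc.
  + change scal with Cmult. unfold v. ceq. rewrite E. field. exact H.
- intros w. unfold v. rewrite E. reflexivity.
Qed.

(** The first two derivatives of [f1 M (S p)]. Using [z ^ p = M - 1 / v z], the
    first one is a polynomial in [v], which makes it easy to differentiate. *)
Let F1 (z : C) : C := (M ^ 2 + K * ((1 - INR p) * v z + INR p * M * (v z * v z)))%C.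
Let F2 (z : C) : C :=
  (K * (INR p * z ^ pred p * ((1 - INR p) * (v z * v z) + 2 * INR p * M * (v z * (v z * v z)))))%C.

Lemma is_Cderive_f1 (z : C) : unit_disk z -> is_Cderive (f1 M (S p)) z (F1 z).
Proof.
intros Hz. assert (H := denominator_nz z Hz).
apply (is_Cderive_ext_disk (fun z => M ^ 2 * z + K * (z * v z))%C);
  [intros; symmetry; apply f1_partial_fraction; assumption|exact Hz|].
replace (F1 z) with (M ^ 2 * 1 + K * (1 * v z + z * (INR p * z ^ pred p * (v z * v z))))%C.
- apply is_Cderive_plus.
  + apply is_Cderive_scal, is_Cderive_id.
  + apply is_Cderive_scal, is_Cderive_mult; [apply is_Cderive_id|apply is_Cderive_v, Hz].
- unfold F1.
  assert (E : (z * z ^ pred p = z ^ p)%C) by (destruct p; [lia|reflexivity]).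
  replace (z * (INR p * z ^ pred p * (v z * v z)))%C
    with (INR p * (z * z ^ pred p) * (v z * v z))%C by ring.
  rewrite E. unfold v. field. exact H.
Qed.

Lemma is_Cderive_F1 (z : C) : unit_disk z -> is_Cderive F1 z (F2 z).
Proof.
intros Hz.
assert (Hv := is_Cderive_v z Hz). set (v' := (INR p * z ^ pred p * (v z * v z))%C) in Hv.
replace (F2 z) with (0 + K * ((1 - INR p) * v' + INR p * M * (v' * v z + v z * v')))%C.
- apply (is_Cderive_plus (fun _ => M ^ 2)%C); [apply is_Cderive_const|].
  apply is_Cderive_scal, is_Cderive_plus; apply is_Cderive_scal; [exact Hv|].
  apply is_Cderive_mult; exact Hv.
- unfold F2, v'. ring.
Qed.

Lemma Ccontinuous_F2 (z : C) : unit_disk z -> Ccontinuous F2 z.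
Proof.
intros Hz. assert (Hv := is_Cderive_v z Hz).
eapply is_Cderive_continuous. unfold F2.
apply is_Cderive_scal, is_Cderive_mult.
- apply is_Cderive_scal, is_Cderive_pow.
- assert (Hv2 := is_Cderive_mult _ _ _ _ _ Hv Hv).
  apply is_Cderive_plus; apply is_Cderive_scal; [exact Hv2|].
  exact (is_Cderive_mult _ _ _ _ _ Hv Hv2).
Qed.

Lemma Re_f1_harmonic (k : C) :
  real_harmonic_on unit_disk (fun x y => Re (k * f1 M (S p) (x, y))%C).
Proof.
apply (Re_holomorphic_harmonic (fun z => k * f1 M (S p) z)%C
  (fun z => k * F1 z)%C (fun z => k * F2 z)%C); intros z Hz.
- apply is_Cderive_scal, is_Cderive_f1, Hz.
- apply is_Cderive_scal, is_Cderive_F1, Hz.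
- apply Ccontinuous_scal, Ccontinuous_F2, Hz.
Qed.

(** The Blaschke-type factor satisfies
    [|M - w| ^ 2 - |1 - M w| ^ 2 = (M ^ 2 - 1) (1 - |w| ^ 2)]. *)
Lemma Cmod_f1_le (z : C) : unit_disk z -> Cmod (f1 M (S p) z) <= M.
Proof.
intros Hz. unfold f1. replace (S p - 1)%nat with p by lia.
assert (Hd := denominator_nz z Hz). assert (Hw := Cmod_pow_disk z Hz).
revert Hd Hw. generalize (z ^ p)%C. intros w Hd Hw.
assert (Hd' := proj1 (Cmod_gt_0 _) Hd).
rewrite !Cmod_mult, Cmod_div, Cmod_R, Rabs_pos_eq by (assumption || lra).
assert (Hle : Cmod (1 - M * w) <= Cmod (M - w)).
{ apply Rsqr_incr_0_var; [|apply Cmod_ge_0].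
  rewrite !Rsqr_pow2, !Cmod2_alt.
  assert (Hw2 : Re w ^ 2 + Im w ^ 2 <= 1).
  { rewrite <- Cmod2_alt. assert (H := Cmod_ge_0 w). nra. }
  assert (H := Rmult_le_pos (M ^ 2 - 1) (1 - (Re w ^ 2 + Im w ^ 2)) ltac:(nra) ltac:(lra)).
  clear - H. destruct w as [x y]. simpl in *. lra. }
unfold unit_disk in Hz. assert (H0 := Cmod_ge_0 z).
assert (Hq : Cmod (1 - M * w) / Cmod (M - w) <= 1) by (apply Rle_div_l; lra).
assert (Hq0 : 0 <= Cmod (1 - M * w) / Cmod (M - w)).
{ apply Rdiv_le_0_compat; [apply Cmod_ge_0|exact Hd']. }
rewrite Rmult_assoc. apply (Rle_trans _ (M * 1)); [|lra].
apply Rmult_le_compat_l; [lra|]. nra.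
Qed.

(** Taylor coefficients of [z / (M - z ^ p)], supported on the exponents
    [1 + p * i]. *)
Definition geom_coef (m : nat) : C :=
  match m with
  | 0%nat => 0
  | S k => if (k mod p =? 0)%nat then / M ^ S (k / p) else 0
  end%C.

Definition f1_coef (m : nat) : C :=
  ((if (m =? 1)%nat then M ^ 2 else 0) + K * geom_coef m)%C.

Lemma M_pow_nz (k : nat) : (M ^ k <> 0)%C.
Proof. apply Cpow_nz. intros E. apply RtoC_inj in E. lra. Qed.

(** The identity [(M - z ^ p) * s = z] read on coefficients. *)
Lemma geom_coef_recurrence (m : nat) :
  (M * geom_coef m - (if Compare_dec.le_lt_dec p m then geom_coef (m - p) else 0)
   = if (m =? 1)%nat then 1 else 0)%C.
Proof.
assert (HM0 := M_pow_nz 1). rewrite Cpow_1_r in HM0.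
destruct m as [|k].
{ simpl. destruct (Compare_dec.le_lt_dec p 0); [lia|ring]. }
destruct (Nat.lt_ge_cases k p) as [Hk|Hk].
- transitivity (M * geom_coef (S k))%C.
  { destruct (Compare_dec.le_lt_dec p (S k)); [|ring].
    replace (S k - p)%nat with 0%nat by lia. simpl. ring. }
  unfold geom_coef. rewrite Nat.mod_small, Nat.div_small by exact Hk.
  destruct k; simpl; [field; exact HM0|ring].
- destruct (Compare_dec.le_lt_dec p (S k)); [|lia].
  destruct (Nat.eqb_spec (S k) 1); [lia|].
  replace (S k - p)%nat with (S (k - p)) by lia. unfold geom_coef.
  assert (Ek : k = ((k - p) + 1 * p)%nat) by lia.
  assert (Emod : (k mod p = (k - p) mod p)%nat).
  { rewrite Ek at 1. apply Nat.Div0.mod_add. }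
  assert (Ediv : (k / p = S ((k - p) / p))%nat).
  { rewrite Ek at 1. rewrite Nat.div_add by lia. lia. }
  rewrite Emod, Ediv.
  destruct (Nat.eqb_spec ((k - p) mod p) 0); [|ring].
  rewrite (Cpow_S M (S _)). field. repeat split; first [exact HM0 | apply M_pow_nz].
Qed.

Lemma Cmod_geom_coef_le (m : nat) : Cmod (geom_coef m) <= 1.
Proof.
destruct m as [|k]; [simpl; rewrite Cmod_0; lra|]. unfold geom_coef.
destruct (Nat.eqb (k mod p) 0); [|rewrite Cmod_0; lra].
rewrite Cmod_inv by apply M_pow_nz.
rewrite Cmod_pow, Cmod_R, Rabs_pos_eq by lra.
rewrite <- Rinv_1. apply Rinv_le_contravar; [lra|]. apply pow_R1_Rle, HM.
Qed.

Lemma is_series_monomial_1 (k z : C) :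
  is_Cseries (fun m => (if (m =? 1)%nat then k else 0) * z ^ m)%C (k * z)%C.
Proof.
apply (proj2 (filterlim_locally_ball_norm _ _)). intros eps.
exists 1%nat. intros n Hn.
rewrite (sum_n_single 1 n); [|exact Hn|].
- simpl. rewrite Cmult_1_r. exact (ball_norm_center (V := C_NormedModule) _ eps).
- intros m _ Hm. apply Nat.eqb_neq in Hm. rewrite Hm. apply Cmult_0_l.
Qed.

(** Once the series is known to converge, the recurrence gives
    [(M - z ^ p) * S = z] for its sum [S]. *)
Lemma is_series_geom_coef (z : C) : unit_disk z ->
  is_Cseries (fun m => geom_coef m * z ^ m)%C (z * v z)%C.
Proof.
intros Hz.
assert (Hex : exists S : C,
  is_Cseries (fun m => geom_coef m * z ^ m)%C S).
{ apply (ex_series_le (V := C_CompleteNormedModule) _ (fun m => Cmod z ^ m)).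
  - intros m. change norm with Cmod. rewrite Cmod_mult, Cmod_pow.
    rewrite <- (Rmult_1_l (Cmod z ^ m)) at 2.
    apply Rmult_le_compat_r; [apply pow_le, Cmod_ge_0|apply Cmod_geom_coef_le].
  - exists (/ (1 - Cmod z)). apply is_series_geom.
    rewrite Rabs_pos_eq; [exact Hz|apply Cmod_ge_0]. }
destruct Hex as [S HS].
assert (Hshift := is_pseries_incr_n (V := C_NormedModule) _ p z S (proj2 (is_pseries_C _ _ _) HS)).
apply is_pseries_C in Hshift.
change scal with Cmult in Hshift. rewrite pow_n_Cpow in Hshift.
assert (HMS := is_series_scal (V := C_NormedModule) (RtoC M) _ _ HS).
assert (Hdiff := is_series_minus _ _ _ _ HMS Hshift).
assert (H1 := is_series_monomial_1 1 z).
assert (E : (M * S - z ^ p * S = 1 * z)%C).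
{ apply (is_series_C_unique _ _ _ Hdiff). revert H1. apply is_series_ext. intros m.
  rewrite <- geom_coef_recurrence, PS_incr_n_simplify.
  change scal with Cmult.
  change (@plus C_NormedModule) with Cplus. change (@opp C_NormedModule) with Copp.
  change (@zero C_NormedModule) with (RtoC 0).
  destruct (Compare_dec.le_lt_dec p m); ceq; ring. }
assert (H := denominator_nz z Hz).
replace (z * v z)%C with (S : C); [exact HS|].
transitivity ((M * S - z ^ p * S) / (M - z ^ p))%C; [ceq; field; exact H|].
rewrite E. unfold v. field. exact H.
Qed.

Lemma f1_disk_series : disk_series f1_coef (f1 M (S p)).
Proof.
split.
- unfold f1_coef. simpl. ring.
- intros z Hz. apply is_pseries_C. rewrite f1_partial_fraction by exact Hz.
  assert (H1 := is_series_monomial_1 (M ^ 2) z).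
  assert (H2 := is_series_scal (V := C_NormedModule) K _ _ (is_series_geom_coef z Hz)).
  assert (H := is_series_plus _ _ _ _ H1 H2). revert H. apply is_series_ext. intros m.
  change plus with Cplus. change scal with Cmult. unfold f1_coef.
  destruct (m =? 1)%nat; ceq; ring.
Qed.

Lemma f1_coef_1 : f1_coef 1 = 1.
Proof.
assert (HM0 := M_pow_nz 1). rewrite Cpow_1_r in HM0.
unfold f1_coef, K, geom_coef. simpl. rewrite Nat.Div0.mod_0_l, Nat.Div0.div_0_l. simpl.
rewrite RtoC_minus, RtoC_mult, RtoC_mult, RtoC_mult. field. exact HM0.
Qed.

Lemma Cmod_f1_coef_extremal : Cmod (f1_coef (S p)) = M - 1 / M.
Proof.
assert (HM0 := M_pow_nz 1). rewrite Cpow_1_r in HM0.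
replace (f1_coef (S p)) with (- RtoC (M - 1 / M))%C.
- rewrite Cmod_opp, Cmod_R, Rabs_pos_eq; [reflexivity|].
  replace (M - 1 / M) with ((M - 1) * (M + 1) / M) by (field; lra).
  apply Rdiv_le_0_compat; [nra|lra].
- unfold f1_coef, K, geom_coef. destruct (Nat.eqb_spec (S p) 1); [lia|].
  rewrite Nat.Div0.mod_same, Nat.div_same by lia. simpl.
  rewrite !RtoC_minus, RtoC_div, !RtoC_mult by lra. field. exact HM0.
Qed.

Lemma disk_series_0 : disk_series (fun _ => RtoC 0) (fun _ => RtoC 0).
Proof.
split; [reflexivity|]. intros z _. apply is_pseries_C.
apply (proj2 (filterlim_locally_ball_norm _ _)). intros eps.
exists 0%nat. intros n _. rewrite sum_n_zero.
- exact (ball_norm_center (V := C_NormedModule) _ eps).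
- intros m _. apply Cmult_0_l.
Qed.
End Extremal.

Lemma real_harmonic_on_ext (u v : R -> R -> R) (D : C -> Prop) :
  (forall x y, u x y = v x y) -> real_harmonic_on D u -> real_harmonic_on D v.
Proof.
intros E H x y Hz. destruct (H x y Hz) as [H1 H2]. split.
- apply (ex_diff_n_ext_loc u); [|exact H1].
  exists (mkposreal 1 Rlt_0_1). intros. apply E.
- rewrite <- H2. unfold partial_derive. simpl.
  f_equal; apply Derive_ext; intros s; apply Derive_ext; intros t; now rewrite E.
Qed.

Lemma f1_extremal (M : R) (n : nat) : 1 <= M -> (2 <= n)%nat ->
  extremal M n (f1 M n) /\ extremal M n (fun z : C => Cconj (f1 M n z)).
Proof.
intros HM Hn. destruct n as [|p]; [lia|]. assert (Hp : (1 <= p)%nat) by lia.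
assert (Hser := f1_disk_series M p HM Hp).
assert (Hbd := Cmod_f1_le M p HM Hp).
assert (Hre := Re_f1_harmonic M p HM Hp).
assert (Hlam : Rabs (Cmod (f1_coef M p 1) - Cmod 0) = 1).
{ rewrite f1_coef_1, Cmod_1, Cmod_0 by assumption. rewrite Rminus_0_r. apply Rabs_R1. }
split.
- exists (f1 M (S p)), (fun _ => RtoC 0), (f1_coef M p), (fun _ => RtoC 0).
  assert (Hdec : forall z, unit_disk z -> f1 M (S p) z = (f1 M (S p) z + Cconj 0)%C).
  { intros z _. apply injective_projections; simpl; ring. }
  split; [constructor|].
  + split.
    * generalize (Hre 1). apply real_harmonic_on_ext. intros x y. now rewrite Cmult_1_l.
    * generalize (Hre (- Ci)%C). apply real_harmonic_on_ext. intros x y.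
      destruct (f1 M (S p) (x, y)). simpl. ring.
  + exact Hdec.
  + exact Hser.
  + apply disk_series_0.
  + intros z Hz. rewrite Cmod_0, Rplus_0_r. apply Hbd, Hz.
  + rewrite (lambda_harmonic_pair_0 _ _ _ _ _ Hdec Hser disk_series_0). exact Hlam.
  + rewrite Cmod_0, Rplus_0_r. apply Cmod_f1_coef_extremal; assumption.
- exists (fun _ => RtoC 0), (f1 M (S p)), (fun _ => RtoC 0), (f1_coef M p).
  assert (Hdec : forall z, unit_disk z -> Cconj (f1 M (S p) z) = (0 + Cconj (f1 M (S p) z))%C).
  { intros z _. ring. }
  split; [constructor|].
  + split.
    * generalize (Hre 1). apply real_harmonic_on_ext. intros x y. now rewrite Cmult_1_l.
    * generalize (Hre Ci). apply real_harmonic_on_ext. intros x y.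
      destruct (f1 M (S p) (x, y)). simpl. ring.
  + exact Hdec.
  + apply disk_series_0.
  + exact Hser.
  + intros z Hz. rewrite Cmod_0, Rplus_0_l. apply Hbd, Hz.
  + rewrite (lambda_harmonic_pair_0 _ _ _ _ _ Hdec disk_series_0 Hser).
    rewrite Rabs_minus_sym. exact Hlam.
  + rewrite Cmod_0, Rplus_0_l. apply Cmod_f1_coef_extremal; assumption.
Qed.

Theorem corollary2p4 :
  (forall (M : R) (f h g : C -> C) (a b : nat -> C),
      0 < M ->
      bounded_harmonic_pair M f h g a b ->
      1 <= M /\
      forall n : nat, (2 <= n)%nat -> Cmod (a n) + Cmod (b n) <= M - 1 / M) /\
  (forall (M : R) (n : nat),
      1 <= M -> (2 <= n)%nat ->
      extremal M n (f1 M n) /\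
      extremal M n (fun z : C => Cconj (f1 M n z))).
Proof.
split; [exact coef_estimate | exact f1_extremal].
Qed.
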